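(* Let $G$ be a finitely generated group with a quotient $G/N$. For any $\ast\in\{gen,st,exp\}$, if $G/N\in\mathcal{FB}_{\ast}\cap\mathcal{QI}_{\ast}$ then $G\in\mathcal{FB}_{\ast}\cap\mathcal{QI}_{\ast}$.
   Context: A finite generating set of a group $G$ is understood as a finite alphabet $X$ together with a map $X\to G$ (not required to be injective) whose image generates $G$; thus for a quotient $G/N$ the alphabet $X$ with the composite $X\to G\to G/N$ is a finite generating set of $G/N$. $F(X)$ is the free group on $X$; words in $F(X)$ are evaluated in $G$. Asymptotic density. Fix $k\ge 1$. The size $s(w_1,\dots,w_k)$ of a tuple in $F(X)^k$ is either $|w_1|+\dots+|w_k|$ or $\max_i|w_i|$ (either choice may be used, fixed throughout). Let $B_n=\{w\in F(X)^k : s(w)\le n\}$ and for $M\subseteq F(X)^k$ let $\rho_n(M)=|B_n\cap M|/|B_n|$. $M$ is generic if $\rho_n(M)\to 1$; strongly generic if moreover $1-\rho_n(M)=o(n^{-r})$ for every $r\in\mathbb N$; exponentially generic if $1-\rho_n(M)\le C\delta^n$ for some $C>0$, $\delta\in(0,1)$ and all $n$. Free basis property. A tuple $(u_1,\dots,u_k)\in F(X)^k$ has the property $\mathcal{FB}$ in $G$ if it freely generates a free subgroup of $G$. Quasi-isometric embedding property. For a group $K$ with finite generating set $Z$ let $d_Z(g,h)$ be the length of a shortest word in $Z^{\pm1}$ representing $g^{-1}h$. A subgroup $H\le G$ generated by a finite set $Y$ is quasi-isometrically embedded in $G$ if there are constants $\lambda>1$, $c>0$ with $\frac1\lambda d_Y(f,h)-c\le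 d_X(f,h)$ for all $f,h\in H$ (this does not depend on the finite generating sets $X$, $Y$). A tuple in $F(X)^k$ has the property $\mathcal{QI}$ in $G$ if the subgroup it generates in $G$ is quasi-isometrically embedded in $G$. $\mathcal{FB}_{gen},\mathcal{FB}_{st},\mathcal{FB}_{exp}$ (resp. $\mathcal{QI}_{gen},\mathcal{QI}_{st},\mathcal{QI}_{exp}$) are the classes of finitely generated groups $G$ such that for every $k\ge1$ and every finite generating set $X$ of $G$ the set of tuples in $F(X)^k$ having property $\mathcal{FB}$ (resp. $\mathcal{QI}$) in $G$ is, respectively, generic, strongly generic, exponentially generic. *)

(* Defs.v *)
From HB Require Import structures.
From mathcomp Require Import all_boot all_order all_algebra.
From mathcomp Require Import finmap generic_quotient.
From mathcomp Require Import boolp classical_sets functions cardinality reals.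
From mathcomp Require Import topology normedtype landau.

Set Implicit Arguments.
Unset Strict Implicit.
Unset Printing Implicit Defensive.

Import Order.TTheory GRing.Theory Num.Theory.
Import numFieldNormedType.Exports.

Local Open Scope classical_set_scope.
Local Open Scope quotient_scope.
Local Open Scope group_scope.

(* Groups are arbitrary (possibly infinite) [groupType]s; the [choiceType]
   structure underlying a [groupType] exists on every type under the classical
   axioms of [boolp], so it is not a restriction. *)

Definition is_subgroup (G : groupType) (H : set G) : Prop :=
  [/\ H 1, forall x y, H x -> H y -> H (x * y) & forall x, H x -> H x^-1].

Definition subgroup_generated (G : groupType) (A : set G) : set G :=
  smallest (@is_subgroup G) A.

Definition generates (G : groupType) (X : Type) (f : X -> G) : Prop :=
  subgroup_generated (range f) = setT.

Definition finitely_generated (G : groupType) : Prop :=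
  exists (X : finType) (f : X -> G), generates f.

Record normal_subgroup (G : groupType) := NormalSubgroup {
  normal_set :> set G;
  normal_is_subgroup : is_subgroup normal_set;
  normal_conjg : forall x g, normal_set x -> normal_set (x ^ g)
}.

Section Quotient.
Variables (G : groupType) (N : normal_subgroup G).

Lemma normal1 : normal_set N 1.
Proof. by case: (normal_is_subgroup N). Qed.

Lemma normalM x y : normal_set N x -> normal_set N y -> normal_set N (x * y).
Proof. by case: (normal_is_subgroup N) => _ + _; apply. Qed.

Lemma normalV x : normal_set N x -> normal_set N x^-1.
Proof. by case: (normal_is_subgroup N) => _ _; apply. Qed.

Definition coset_rel (x y : G) : bool := `[< normal_set N (x^-1 * y) >].

Lemma coset_rel_refl : reflexive coset_rel.
Proof. move=> x; apply/asboolP; rewrite mulVg; exact: normal1. Qed.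

Lemma coset_rel_sym : symmetric coset_rel.
Proof.
by move=> x y; apply/asboolP/asboolP => /normalV; rewrite invgM invgK.
Qed.

Lemma coset_rel_trans : transitive coset_rel.
Proof.
move=> y x z /asboolP xy /asboolP yz; apply/asboolP.
by have := normalM xy yz; rewrite -mulgA mulVKg.
Qed.

Definition coset_equiv :=
  EquivRel coset_rel coset_rel_refl coset_rel_sym coset_rel_trans.

Definition quotient_group : Type := {eq_quot coset_equiv}.

HB.instance Definition _ := EqQuotient.on quotient_group.
HB.instance Definition _ := Choice.on quotient_group.

Definition quotient_map (x : G) : quotient_group := \pi_quotient_group x.

Lemma quotient_map_eqP (x y : G) :
  quotient_map x = quotient_map y <-> normal_set N (x^-1 * y).
Proof.
split; first by move/(@eqmodP _ coset_equiv) => /asboolP.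
by move=> xy; apply/(@eqmodP _ coset_equiv)/asboolP.
Qed.

Lemma quotient_map_surj (a : quotient_group) : exists x, quotient_map x = a.
Proof. by exists (repr a); rewrite /quotient_map reprK. Qed.

Definition quotient_one : quotient_group := quotient_map 1.
Definition quotient_inv (a : quotient_group) : quotient_group :=
  quotient_map (repr a)^-1.
Definition quotient_mul (a b : quotient_group) : quotient_group :=
  quotient_map (repr a * repr b).

Lemma quotient_map_repr (x : G) : normal_set N ((repr (quotient_map x))^-1 * x).
Proof. by apply/quotient_map_eqP; rewrite /quotient_map reprK. Qed.

Lemma quotient_mapV (x : G) :
  quotient_inv (quotient_map x) = quotient_map x^-1.
Proof.
apply/quotient_map_eqP; rewrite invgK.
have := normal_conjg x^-1 (normalV (quotient_map_repr x)).
by rewrite conjgE !invgM !invgK !mulgA mulgV mul1g.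
Qed.

Lemma quotient_mapM (x y : G) :
  quotient_mul (quotient_map x) (quotient_map y) = quotient_map (x * y).
Proof.
apply/quotient_map_eqP; rewrite invgM -mulgA (mulgA _ x).
rewrite -{2}(mulVKg (repr (quotient_map y)) y) (mulgA _ (repr _)) mulgA.
apply: normalM; last exact: quotient_map_repr.
exact: (normal_conjg _ (quotient_map_repr x)).
Qed.

Lemma quotient_mulA : associative quotient_mul.
Proof.
move=> a b c; have [[[x <-] [y <-]] [z <-]] :=
  (quotient_map_surj a, quotient_map_surj b, quotient_map_surj c).
by rewrite !quotient_mapM mulgA.
Qed.

Lemma quotient_mul1 : left_id quotient_one quotient_mul.
Proof.
by move=> a; have [x <-] := quotient_map_surj a; rewrite quotient_mapM mul1g.
Qed.

Lemma quotient_mulr1 : right_id quotient_one quotient_mul.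
Proof.
by move=> a; have [x <-] := quotient_map_surj a; rewrite quotient_mapM mulg1.
Qed.

Lemma quotient_mulV : left_inverse quotient_one quotient_inv quotient_mul.
Proof.
move=> a; have [x <-] := quotient_map_surj a.
by rewrite quotient_mapV quotient_mapM mulVg.
Qed.

Lemma quotient_mulrV : right_inverse quotient_one quotient_inv quotient_mul.
Proof.
move=> a; have [x <-] := quotient_map_surj a.
by rewrite quotient_mapV quotient_mapM mulgV.
Qed.

HB.instance Definition _ := isGroup.Build quotient_group
  quotient_mulA quotient_mul1 quotient_mulr1 quotient_mulV quotient_mulrV.

End Quotient.

(* A letter [(x, false)] stands for the generator x, [(x, true)] for x^-1. *)
Section Words.
Variables (G : groupType) (X : Type) (f : X -> G).

Definition eval_letter (a : X * bool) : G := if a.2 then (f a.1)^-1 else f a.1.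

Definition eval_word (w : seq (X * bool)) : G := \prod_(a <- w) eval_letter a.

End Words.

Definition inverse_letters (X : eqType) (a b : X * bool) : bool :=
  (a.1 == b.1) && (a.2 != b.2).

Definition reduced (X : eqType) (w : seq (X * bool)) : bool :=
  sorted (fun a b => ~~ inverse_letters a b) w.

(* The free group on X, each element being represented by its unique freely
   reduced word; [eval_word f] is then the homomorphism extending f, and the
   length of an element is the [size] of the word. *)
Record free_group (X : eqType) := FreeGroup {
  free_word :> seq (X * bool);
  free_word_reduced : reduced free_word
}.

HB.instance Definition _ (X : eqType) := [isSub for @free_word X].
HB.instance Definition _ (X : eqType) := [Equality of free_group X by <:].
HB.instance Definition _ (X : choiceType) := [Choice of free_group X by <:].

Definition eval_free (G : groupType) (X : eqType) (f : X -> G)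
  (u : free_group X) : G := eval_word f u.

(* The values in G of the entries of a tuple of elements of F(X). *)
Definition tuple_values (G : groupType) (X : eqType) (f : X -> G) (k : nat)
    (u : k.-tuple (free_group X)) (i : 'I_k) : G :=
  eval_free f (tnth u i).

(* The homomorphism from the free group of rank k to G sending the i-th free
   generator to the value of the i-th entry is injective. *)
Definition free_basis (G : groupType) (X : eqType) (f : X -> G) (k : nat)
    (u : k.-tuple (free_group X)) : Prop :=
  injective (eval_free (tuple_values f u)).

(* The default value 0 is used only when g is not in the subgroup generated
   by the image of f. *)
Definition word_length (K : groupType) (Z : Type) (f : Z -> K) (g : K) : nat :=
  xget 0%N [set n : nat |
    (exists w : seq (Z * bool), size w = n /\ eval_word f w = g) /\
    (forall w : seq (Z * bool), eval_word f w = g -> (n <= size w)%N)].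

Definition word_dist (K : groupType) (Z : Type) (f : Z -> K) (g h : K) : nat :=
  word_length f (g^-1 * h).

(* [x : X -> G] generates G and [y : Y -> G] generates the subgroup H.  For g, h
   in H, [word_dist y g h] is their distance d_Y in H, since words in Y take
   the same values in H and in G. *)
Definition qi_embedded (R : realType) (G : groupType) (X Y : finType)
    (x : X -> G) (y : Y -> G) : Prop :=
  exists lambda c : R, [/\ (1 < lambda)%R, (0 < c)%R &
    forall g h, subgroup_generated (range y) g ->
      subgroup_generated (range y) h ->
      (lambda^-1 * (word_dist y g h)%:R - c <= (word_dist x g h)%:R)%R].

Definition qi_tuple (R : realType) (G : groupType) (X : finType) (f : X -> G)
    (k : nat) (u : k.-tuple (free_group X)) : Prop :=
  qi_embedded R f (tuple_values f u).

Inductive size_choice := SumSize | MaxSize.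

Definition tuple_size (s : size_choice) (X : eqType) (k : nat)
    (u : k.-tuple (free_group X)) : nat :=
  match s with
  | SumSize => (\sum_(i < k) size (tnth u i))%N
  | MaxSize => (\max_(i < k) size (tnth u i))%N
  end.

Definition tuple_ball (s : size_choice) (X : eqType) (k n : nat) :
    set (k.-tuple (free_group X)) :=
  [set u | (tuple_size s u <= n)%N].

Section Density.
Local Open Scope ring_scope.
Variables (R : realType) (s : size_choice) (X : finType) (k : nat).
Implicit Type M : set (k.-tuple (free_group X)).

(* Balls are finite, so [fset_set] enumerates them. *)
Definition density M (n : nat) : R :=
  #|` fset_set (tuple_ball s n `&` M)|%:R
    / #|` fset_set (@tuple_ball s X k n)|%:R.

Definition generic M : Prop := density M n @[n --> \oo] --> (1 : R).

Definition strongly_generic M : Prop :=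
  generic M /\
  forall r : nat,
    (fun n : nat => 1 - density M n) =o_\oo (fun n : nat => (n%:R : R) ^- r).

Definition exponentially_generic M : Prop :=
  exists C delta : R, [/\ 0 < C, 0 < delta < 1 &
    forall n : nat, 1 - density M n <= C * delta ^+ n].

End Density.

Inductive genericity := gen | st | exp.

Definition is_generic (R : realType) (s : size_choice) (t : genericity)
    (X : finType) (k : nat) (M : set (k.-tuple (free_group X))) : Prop :=
  match t with
  | gen => generic R s M
  | st => strongly_generic R s M
  | exp => exponentially_generic R s M
  end.

Definition FB_class (R : realType) (s : size_choice) (t : genericity)
    (G : groupType) : Prop :=
  finitely_generated G /\
  forall (k : nat) (X : finType) (f : X -> G), (1 <= k)%N -> generates f ->
    is_generic R s t [set u : k.-tuple (free_group X) | free_basis f u].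

Definition QI_class (R : realType) (s : size_choice) (t : genericity)
    (G : groupType) : Prop :=
  finitely_generated G /\
  forall (k : nat) (X : finType) (f : X -> G), (1 <= k)%N -> generates f ->
    is_generic R s t [set u : k.-tuple (free_group X) | qi_tuple R f u].

(* Main.v *)
Require Import Defs.
From HB Require Import structures.
From mathcomp Require Import all_boot all_order all_algebra.
From mathcomp Require Import finmap lra.
From mathcomp Require Import boolp functions cardinality.
From mathcomp Require Import topology normedtype landau.
From mathcomp Require Import classical_sets reals.

(** If a tuple has properties FB and QI in G/N, then it has both in G: a word
    that is nontrivial in G/N is nontrivial in G, and the projection is
    1-Lipschitz while it maps the subgroup H generated by the tuple
    isomorphically, hence isometrically for the word metrics of the tuple, onto
    its image; so the lower bound on distances pulls back.  Finally, each of the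
    three kinds of generic sets is stable under supersets and intersections,
    since the complement of A `&` B has density at most the sum of those of A
    and B. *)

Set Implicit Arguments.
Unset Strict Implicit.
Unset Printing Implicit Defensive.

Import Order.TTheory GRing.Theory Num.Theory.
Import numFieldNormedType.Exports.

Local Open Scope classical_set_scope.
Local Open Scope group_scope.

(** * Values of words, word length and free reduction *)

Section WordValues.
Variables (G : groupType) (X : Type) (f : X -> G).

Lemma eval_word_nil : eval_word f [::] = 1.
Proof. by rewrite /eval_word big_nil. Qed.

Lemma eval_word_cons a w : eval_word f (a :: w) = eval_letter f a * eval_word f w.
Proof. by rewrite /eval_word big_cons. Qed.

Lemma eval_word_cat v w : eval_word f (v ++ w) = eval_word f v * eval_word f w.
Proof. by rewrite /eval_word big_cat. Qed.

Lemma is_subgroup_eval_word : is_subgroup (range (eval_word f)).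
Proof.
split; first by exists [::]; rewrite ?eval_word_nil.
  by move=> _ _ [v _ <-] [w _ <-]; exists (v ++ w); rewrite ?eval_word_cat.
move=> _ [w _ <-]; elim: w => [|[x b] w [v _ IHw]].
  by exists [::]; rewrite // eval_word_nil invg1.
(* The inverse is spelled by the reversed word with all exponents flipped. *)
exists (v ++ [:: (x, ~~ b)]) => //.
rewrite eval_word_cat !eval_word_cons eval_word_nil mulg1 invgM IHw.
by case: b; rewrite /eval_letter /= ?invgK.
Qed.

Lemma subgroup_generated_word g :
  subgroup_generated (range f) g -> exists w, eval_word f w = g.
Proof.
have sub : range f `<=` range (eval_word f).
  move=> _ [x _ <-]; exists [:: (x, false)] => //.
  by rewrite eval_word_cons eval_word_nil mulg1.
by case/(smallest_sub is_subgroup_eval_word sub) => w _ <-; exists w.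
Qed.

Lemma generates_word g : generates f -> exists w, eval_word f w = g.
Proof. by move=> genf; apply: subgroup_generated_word; rewrite genf. Qed.

(** Some length is attained, hence a least one is, so the default value 0 of [xget] never intervenes
    for such a [g]. *)
Lemma word_lengthP g : (exists w, eval_word f w = g) ->
  (exists w, size w = word_length f g /\ eval_word f w = g) /\
  (forall w, eval_word f w = g -> (word_length f g <= size w)%N).
Proof.
move=> gP; rewrite /word_length; case: xgetP => [//|noword].
pose P n := `[< exists w, size w = n /\ eval_word f w = g >].
have exP : exists n, P n.
  by have [w wg] := gP; exists (size w); apply/asboolP; exists w.
case: (ex_minnP exP) => n /asboolP nw nmin; case: (noword n); split=> // w wg.
by apply: nmin; apply/asboolP; exists w.
Qed.

End WordValues.

Lemma eval_letter_inverse (G : groupType) (X : eqType) (f : X -> G) a b :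
  inverse_letters a b -> eval_letter f a * eval_letter f b = 1.
Proof.
case: a b => [x c] [y d] /andP[/= /eqP <-].
by case: c d => -[] //= _; rewrite /eval_letter /= ?mulgV ?mulVg.
Qed.

(** Letters are added on the left of a reduced word, cancelling with its head when possible. Since
    [u] is chosen before [G] and [f], the same reduced word serves in a group and in its image. *)
Lemma reduced_word (X : eqType) (w : seq (X * bool)) :
  exists u : free_group X,
    forall (G : groupType) (f : X -> G), eval_free f u = eval_word f w.
Proof.
elim: w => [|a w [[u ured] uw]]; first by exists (@FreeGroup X [::] isT).
case: u ured uw => [|b u] ured uw.
  exists (@FreeGroup X [:: a] isT) => G f.
  by rewrite /eval_free /= !eval_word_cons -uw.
have [ab|nab] := boolP (inverse_letters a b).
  exists (@FreeGroup X u (path_sorted ured)) => G f.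
  rewrite eval_word_cons -uw /eval_free /= eval_word_cons mulgA.
  by rewrite eval_letter_inverse // mul1g.
have abred : reduced [:: a, b & u] by rewrite /reduced /= nab.
exists (FreeGroup abred) => G f.
by rewrite [RHS]eval_word_cons -uw /eval_free -eval_word_cons.
Qed.

(** * Pulling both properties back along a homomorphism *)

Section Homomorphism.
Variables (G H : groupType) (h : UMagmaMorphism.type G H).

Lemma eval_word_comp (X : Type) (f : X -> G) w :
  eval_word (h \o f) w = h (eval_word f w).
Proof.
rewrite /eval_word gmulf_prod; apply: eq_bigr => -[x b] _.
by case: b; rewrite /eval_letter /= ?gmulfV.
Qed.

Lemma tuple_values_comp (X : eqType) (f : X -> G) k
    (u : k.-tuple (free_group X)) :
  tuple_values (h \o f) u = h \o tuple_values f u.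
Proof. by apply/funext => i; exact: eval_word_comp. Qed.

Lemma free_basis_comp (X : eqType) (f : X -> G) k
    (u : k.-tuple (free_group X)) :
  free_basis (h \o f) u -> free_basis f u.
Proof.
rewrite /free_basis tuple_values_comp => inj v w vw; apply: inj.
by rewrite /eval_free !eval_word_comp -!/(eval_free _ _) vw.
Qed.

Lemma generates_comp (X : Type) (f : X -> G) :
  (forall y, exists x, h x = y) -> generates f -> generates (h \o f).
Proof.
move=> hsurj genf; apply/seteqP; split=> // y _; have [x <-] := hsurj y.
suff sub : subgroup_generated (range f) `<=`
    [set z | subgroup_generated (range (h \o f)) (h z)].
  by apply: sub; rewrite genf.
(* The preimage under [h] of the generated subgroup is a subgroup containing the generators. *)
apply: smallest_sub.
  split=> [|z1 z2 h1 h2|z1 h1] /= S [Ssub Sf]; have [S1 SM SV] := Ssub.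
  - by rewrite gmulf1.
  - by rewrite gmulfM; apply: SM; [apply: h1|apply: h2].
  - by rewrite gmulfV; apply: SV; apply: h1.
by move=> _ [z _ <-] /= S [_]; apply; exists z.
Qed.

Lemma word_length_comp_le (X : Type) (f : X -> G) g :
  (exists w, eval_word f w = g) ->
  (word_length (h \o f) (h g) <= word_length f g)%N.
Proof.
move=> gP; have [[w [<- wg]] _] := word_lengthP gP.
have hwg : eval_word (h \o f) w = h g by rewrite eval_word_comp wg.
by apply: (word_lengthP (ex_intro _ w hwg)).2.
Qed.

(** A shortest word for [h g] and any word for [g] have the same value under [h \o y]. By
    injectivity they have the same reduced form, so the shortest word already spells [g]. *)
Lemma word_length_comp_inj (Y : eqType) (y : Y -> G) g :
  injective (eval_free (h \o y)) -> (exists w, eval_word y w = g) ->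
  (word_length y g <= word_length (h \o y) (h g))%N.
Proof.
move=> inj gP; have [v vg] := gP.
have [|[w [<- wg]] _] := @word_lengthP _ _ (h \o y) (h g).
  by exists v; rewrite eval_word_comp vg.
apply: (word_lengthP gP).2.
have [[v' vE] [w' wE]] := (reduced_word v, reduced_word w).
rewrite -vg -vE -wE; congr eval_free; apply: inj.
by rewrite vE wE wg -vg eval_word_comp.
Qed.

(** The constants of the image work unchanged: the distance for [y] is at most that for [h \o y],
    and the distance for [h \o x] is at most that for [x]. *)
Lemma qi_embedded_comp (R : realType) (X Y : finType) (x : X -> G)
    (y : Y -> G) :
  generates x -> injective (eval_free (h \o y)) ->
  qi_embedded R (h \o x) (h \o y) -> qi_embedded R x y.
Proof.
move=> genx inj [l [c [l1 c0 lc]]]; exists l, c; split=> // g1 g2 g1P g2P.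
have [[w1 w1E] [w2 w2E]] :=
  (subgroup_generated_word g1P, subgroup_generated_word g2P).
have imP w : subgroup_generated (range (h \o y)) (h (eval_word y w)).
  rewrite -eval_word_comp => S [[S1 SM SV] Sy].
  elim: w => [|[z b] w IHw]; first by rewrite eval_word_nil.
  rewrite eval_word_cons; apply: SM IHw.
  have Sz : S ((h \o y) z) by apply: Sy; exists z.
  by case: b; rewrite /eval_letter //=; apply: SV.
have g12P : exists w, eval_word y w = g1^-1 * g2.
  have [_ M V] := is_subgroup_eval_word y.
  rewrite -w1E -w2E; have [| |w _ <-] := M (eval_word y w1)^-1 (eval_word y w2).
  - by apply: V; exists w1.
  - by exists w2.
  - by exists w.
have := lc _ _ (imP w1) (imP w2); rewrite w1E w2E /word_dist -gmulfV -gmulfM.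
have /word_length_comp_le lex : exists w, eval_word x w = g1^-1 * g2.
  exact: generates_word.
rewrite -(ler_nat R) in lex; move=> /le_trans/(_ lex); apply: le_trans.
rewrite lerD2r ler_wpM2l ?invr_ge0 ?(le_trans _ (ltW l1)) // ler_nat.
exact: word_length_comp_inj.
Qed.

Lemma qi_tuple_comp (R : realType) (X : finType) (f : X -> G) k
    (u : k.-tuple (free_group X)) :
  generates f -> free_basis (h \o f) u -> qi_tuple R (h \o f) u ->
  qi_tuple R f u.
Proof.
rewrite /free_basis /qi_tuple tuple_values_comp; exact: qi_embedded_comp.
Qed.

End Homomorphism.

(** Makes the projection onto the quotient an instance of the homomorphism [h] above. *)
HB.instance Definition _ (G : groupType) (N : normal_subgroup G) :=
  isUMagmaMorphism.Build G (quotient_group N) (@quotient_map G N)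
    (erefl, fun x y => esym (quotient_mapM N x y)).

(** * Density estimates and stability of generic sets *)

Section Density.
Local Open Scope ring_scope.
Variables (R : realType) (s : size_choice) (X : finType) (k : nat).
Implicit Types A B C : set (k.-tuple (free_group X)).

Let ball n := @tuple_ball s X k n.

Lemma finite_tuple_ball n : finite_set (ball n).
Proof.
(* The ball is covered by the image of a finite type, the tuples of words of length at most [n];
   non-reduced words are sent to the empty word. *)
pose g (v : k.-tuple (n.-bseq (X * bool))) : k.-tuple (free_group X) :=
  [tuple insubd (@FreeGroup X [::] isT) (bseqval (tnth v i)) | i < k].
apply: (@sub_finite_set _ _ (range g)); last exact/finite_image/finite_finset.
move=> u un; have {}un i : (size (tnth u i) <= n)%N.
  apply: leq_trans un; rewrite /tuple_size; case: (s).
    by rewrite (bigD1 i) //= leq_addr.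
  exact: (leq_bigmax i).
exists [tuple insub_bseq n (tnth u i) | i < k] => //.
apply: eq_from_tnth => i; rewrite !tnth_mktuple.
have -> : bseqval (insub_bseq n (tnth u i)) = free_word (tnth u i).
  rewrite /insub_bseq insubdK //; exact: un.
by rewrite valKd.
Qed.

(** The tuple of empty words lies in every ball, so densities have nonzero denominators. *)
Let card_ball n : (0 < #|` fset_set (ball n)|)%N.
Proof.
rewrite cardfs_gt0; apply/fset0Pn.
exists [tuple @FreeGroup X [::] isT | i < k].
rewrite in_fset_set ?inE; last exact: finite_tuple_ball.
rewrite /ball /tuple_ball /= /tuple_size.
by case: (s); rewrite ?big1 // => i _; rewrite tnth_mktuple.
Qed.

Lemma density_le1 A n : density R s A n <= 1.
Proof.
rewrite /density ler_pdivrMr ?ltr0n // mul1r ler_nat fsubset_leq_card //.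
have fB := finite_tuple_ball n.
by rewrite -fset_set_sub //; exact: finite_setIl.
Qed.

Lemma density_setI A B C n : A `&` B `<=` C ->
  1 - density R s C n <= (1 - density R s A n) + (1 - density R s B n).
Proof.
move=> ABC; have fB := finite_tuple_ball n.
have fin D : finite_set (ball n `&` D) by exact: finite_setIl.
pose c D := #|` fset_set (ball n `&` D)|.
suff: (c A + c B <= #|` fset_set (ball n)| + c C)%N.
  rewrite -(ler_nat R) !natrD => le_c.
  have b0 : 0 < (#|` fset_set (ball n)|%:R : R) by rewrite ltr0n.
  rewrite -(ler_pM2r b0) !(mulrDl, mulrBl, mulNr) !divfK ?gt_eqF //.
  by rewrite mul1r; move: le_c; rewrite /c /ball; lra.
(* Inclusion-exclusion: within the ball, the union of [A] and [B] is bounded by the whole ball and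
   their intersection by [C]. *)
rewrite /c -cardfsUI leq_add //; apply: fsubset_leq_card.
  rewrite -fset_setU // -fset_set_sub //; last by rewrite finite_setU.
  by move=> u [] [].
rewrite -fset_setI // -fset_set_sub //; last exact: finite_setIl.
by move=> u [[un uA] [_ uB]]; split=> //; exact: ABC.
Qed.

Lemma generic_setI A B C : A `&` B `<=` C ->
  generic R s A -> generic R s B -> generic R s C.
Proof.
move=> ABC gA gB; rewrite /generic.
apply: (@squeeze_cvgr _ _ _ _
  (fun n => density R s A n + density R s B n - 1) (fun=> 1)).
- near=> n; rewrite density_le1 andbT.
  by have := density_setI n ABC; lra.
- by have := cvgB (cvgD gA gB) (cvg_cst (1 : R)); rewrite addrK; exact.
- exact: cvg_cst.
Unshelve. all: by end_near. Qed.

Lemma strongly_generic_setI A B C : A `&` B `<=` C ->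
  strongly_generic R s A -> strongly_generic R s B -> strongly_generic R s C.
Proof.
move=> ABC [gA oA] [gB oB]; split=> [|r]; first exact: generic_setI gA gB.
(* Each of the two complements is allotted half of the error. *)
apply/eqoP => e e0; have e20 : 0 < e / 2 by rewrite divr_gt0.
move: (oA r) (oB r) => /eqoP/(_ _ e20) hA /eqoP/(_ _ e20) hB.
near=> n.
have leA : `|1 - density R s A n| <= e / 2 * `|(n%:R : R) ^- r|.
  by near: n; exact: hA.
have leB : `|1 - density R s B n| <= e / 2 * `|(n%:R : R) ^- r|.
  by near: n; exact: hB.
rewrite ger0_norm ?subr_ge0 ?density_le1 //.
apply: le_trans (density_setI n ABC) _.
apply: le_trans (lerD (ler_norm _) (ler_norm _)) _.
by rewrite (le_trans (lerD leA leB)) // -mulrDl -splitr.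
Unshelve. all: by end_near. Qed.

Lemma exponentially_generic_setI A B C : A `&` B `<=` C ->
  exponentially_generic R s A -> exponentially_generic R s B ->
  exponentially_generic R s C.
Proof.
move=> ABC [a [d [a0 /andP[d0 d1] hA]]] [b [e [b0 /andP[e0 e1] hB]]].
(* The slower of the two decay rates dominates both exponentials. *)
exists (a + b), (Num.max d e); split; first exact: addr_gt0.
  by rewrite lt_max d0 gt_max d1.
move=> n; apply: le_trans (density_setI n ABC) _.
rewrite mulrDl lerD //.
  apply: le_trans (hA n) _; rewrite ler_pM2l // lerXn2r ?le_max ?lexx //.
  - by rewrite nnegrE ltW.
  - by rewrite nnegrE le_max ltW.
apply: le_trans (hB n) _; rewrite ler_pM2l // lerXn2r ?le_max ?lexx ?orbT //.
- by rewrite nnegrE ltW.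
- by rewrite nnegrE le_max (ltW d0).
Qed.

Lemma is_generic_setI t A B C : A `&` B `<=` C ->
  is_generic R s t A -> is_generic R s t B -> is_generic R s t C.
Proof.
by case: t; [exact: generic_setI|exact: strongly_generic_setI
  |exact: exponentially_generic_setI].
Qed.

End Density.

Theorem theorem2p12 (R : realType) (s : size_choice) (t : genericity)
    (G : groupType) (N : normal_subgroup G) :
  finitely_generated G ->
  FB_class R s t (quotient_group N) /\ QI_class R s t (quotient_group N) ->
  FB_class R s t G /\ QI_class R s t G.
Proof.
move=> fgG [[_ FBq] [_ QIq]].
have genq (X : finType) (f : X -> G) :
    generates f -> generates (quotient_map N \o f).
  exact/generates_comp/quotient_map_surj.
split; split=> // k X f k1 genf; have genqf := genq X f genf.
  (* Intersecting the set with itself yields stability under supersets. *)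
  apply: (is_generic_setI _ (FBq k X _ k1 genqf) (FBq k X _ k1 genqf)).
  by move=> u [+ _]; exact: free_basis_comp.
(* Pulling back the QI property also uses freeness in the quotient, hence the intersection of both
   generic sets. *)
apply: (is_generic_setI _ (FBq k X _ k1 genqf) (QIq k X _ k1 genqf)).
by move=> u []; exact: qi_tuple_comp.
Qed.
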